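(* Let $\alpha$ be a curve in $\mathbb{R}^3$ parametrized by arc length, with curvature greater than zero. If $\alpha$ is a rectifying curve and it is at the same time a slant helix, then it can be parametrized as $$\alpha(s)=\frac{1}{a}\sqrt{1+(as+b)^2}\left(\sin\psi_0\cos\left[\frac{c+\arctan(as+b)}{\sin\psi_0}\right],\ \sin\psi_0\sin\left[\frac{c+\arctan(as+b)}{\sin\psi_0}\right],\ \cos\psi_0\right),$$ where $a,b,c,\psi_0$ are real constants, $0<a$, $0<\psi_0<\frac{\pi}{2}$.
   Context: For a unit speed curve $\alpha=\alpha(s)$ in $\mathbb{R}^3$ with positive curvature $\kappa$, the Frenet frame is $\mathbf{t}=\alpha'$, $\mathbf{n}=\alpha''/\kappa$ (principal normal), $\mathbf{b}=\mathbf{t}\times\mathbf{n}$. Rectifying curve: a unit speed curve whose position vector always lies in its rectifying plane, i.e. $\alpha(s)\in\operatorname{span}\{\mathbf{t}(s),\mathbf{b}(s)\}$ for all $s$. Slant helix: a unit speed curve with nonzero curvature whose principal normal lines make a constant angle with a fixed direction, i.e. there is a fixed unit vector $U\in\mathbb{R}^3$ such that $\langle\mathbf{n}(s),U\rangle$ is constant in $s$. *)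

(* Defs.v *)
From HB Require Import structures.
From mathcomp Require Import all_boot all_order all_algebra.
From mathcomp Require Import all_classical all_reals all_analysis.

Set Implicit Arguments.
Unset Strict Implicit.
Unset Printing Implicit Defensive.

Import Order.TTheory GRing.Theory Num.Theory.
Import numFieldNormedType.Exports.

Local Open Scope classical_set_scope.
Local Open Scope ring_scope.

Definition vec3 (R : realType) (x y z : R) : 'rV[R]_3 :=
  \row_(i < 3) [:: x; y; z]`_i.

(* The library norm on 'rV[R]_3 is the max norm, hence the explicit Euclidean
   structure.  The two norms are equivalent, so derivatives do not depend on
   this choice. *)
Definition dot (R : realType) (u v : 'rV[R]_3) : R :=
  \sum_(i < 3) u 0 i * v 0 i.

Definition enorm (R : realType) (u : 'rV[R]_3) : R := Num.sqrt (dot u u).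

Definition cross (R : realType) (u v : 'rV[R]_3) : 'rV[R]_3 :=
  let x (w : 'rV[R]_3) := w 0 (inord 0%N) in
  let y (w : 'rV[R]_3) := w 0 (inord 1%N) in
  let z (w : 'rV[R]_3) := w 0 (inord 2%N) in
  vec3 (y u * z v - z u * y v)
       (z u * x v - x u * z v)
       (x u * y v - y u * x v).

Definition tangent (R : realType) (alpha : R -> 'rV[R]_3) : R -> 'rV[R]_3 :=
  derive1 alpha.

Definition curvature (R : realType) (alpha : R -> 'rV[R]_3) (s : R) : R :=
  enorm (derive1 (derive1 alpha) s).

Definition normal (R : realType) (alpha : R -> 'rV[R]_3) (s : R) : 'rV[R]_3 :=
  (curvature alpha s)^-1 *: derive1 (derive1 alpha) s.

Definition binormal (R : realType) (alpha : R -> 'rV[R]_3) (s : R) : 'rV[R]_3 :=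
  cross (tangent alpha s) (normal alpha s).

(* The second derivative is the least regularity for which curvature and
   principal normal make sense; smooth curves are a special case. *)
Definition unit_speed (R : realType) (I : set R) (alpha : R -> 'rV[R]_3) :
    Prop :=
  forall s, I s ->
    [/\ derivable alpha s 1, derivable (derive1 alpha) s 1
      & enorm (derive1 alpha s) = 1].

Definition rectifying (R : realType) (I : set R) (alpha : R -> 'rV[R]_3) :
    Prop :=
  unit_speed I alpha /\
  forall s, I s -> alpha s \in <<[:: tangent alpha s; binormal alpha s]>>%VS.

Definition slant_helix (R : realType) (I : set R) (alpha : R -> 'rV[R]_3) :
    Prop :=
  [/\ unit_speed I alpha,
      forall s, I s -> curvature alpha s != 0
    & exists U : 'rV[R]_3, enorm U = 1 /\
        exists k : R, forall s, I s -> dot (normal alpha s) U = k].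

(* Main.v *)
(* For a rectifying curve f = <alpha, t> has f' = 1 and |alpha|^2 - f^2 = m is a
   positive constant.  Let U be the axis, z = <alpha, U> and
   D = det(alpha, t, U).  As n is +-(alpha x t)/sqrt m, the slant condition
   reads D^2 = m k^2; so D' = det(alpha, t', U) = 0, which amounts to
   |alpha|^2 z' = f z, that is, z = C |alpha|: the curve lies on a circular cone
   with axis U.  Since D is the angular momentum around U, it determines the
   angular velocity, which integrates to an arctangent.

   Continuity of the second derivative is not available, so the moving frame is
   never differentiated: signs are handled by squaring. *)
Require Import Defs.
From HB Require Import structures.
From mathcomp Require Import all_boot all_order all_algebra.
From mathcomp Require Import all_classical all_reals all_analysis.
From mathcomp Require Import ring lra.

Set Implicit Arguments.
Unset Strict Implicit.
Unset Printing Implicit Defensive.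

Import Order.TTheory GRing.Theory Num.Theory.
Import numFieldNormedType.Exports.

Local Open Scope classical_set_scope.
Local Open Scope ring_scope.

(** * Derivatives of real functions on an interval, and angles with prescribed cosine and sine *)

Section RealFunctions.
Variable R : realType.
Implicit Types (I : set R) (f g h : R -> R) (s : R).

Lemma is_derive_add f g s df dg :
  is_derive s 1 f df -> is_derive s 1 g dg ->
  is_derive s 1 (fun t => f t + g t) (df + dg).
Proof. exact: is_deriveD. Qed.

Lemma is_derive_sub f g s df dg :
  is_derive s 1 f df -> is_derive s 1 g dg ->
  is_derive s 1 (fun t => f t - g t) (df - dg).
Proof. exact: is_deriveB. Qed.

Lemma is_derive_mul f g s df dg :
  is_derive s 1 f df -> is_derive s 1 g dg ->
  is_derive s 1 (fun t => f t * g t) (df * g s + f s * dg).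
Proof.
move=> hf hg; apply: is_derive_eq (is_deriveM hf hg) _.
by rewrite /GRing.scale/=; ring.
Qed.

Lemma is_derive_comp f g s df dg :
  is_derive (g s) 1 f df -> is_derive s 1 g dg ->
  is_derive s 1 (fun t => f (g t)) (df * dg).
Proof. by move=> hf hg; exact: is_derive1_comp. Qed.

Lemma is_derive_inv f s df : f s != 0 -> is_derive s 1 f df ->
  is_derive s 1 (fun t => (f t)^-1) (- (df / f s ^+ 2)).
Proof.
move=> f0 hf; apply: is_derive_eq (is_deriveV f0 hf) _.
by rewrite /GRing.scale/= mulNr mulrC.
Qed.

Lemma derive_unique f s d1 d2 :
  is_derive s 1 f d1 -> is_derive s 1 f d2 -> d1 = d2.
Proof. by move=> [_ <-] [_ <-]. Qed.

Lemma derive_constant_on I f c s d : open I -> I s ->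
  (forall t, I t -> f t = c) -> is_derive s 1 f d -> d = 0.
Proof.
move=> oI Is fc fd; apply: derive_unique fd _.
apply: (@near_eq_is_derive _ _ _ (cst c)).
by near=> t; rewrite fc//; near: t; exact: open_nbhs_nbhs.
Unshelve. all: by end_near. Qed.

(** Differentiating gives 2 f f' = 0. If [f s = 0], then [c] is 0 and [f] vanishes on all of [I], so
    its derivative is 0 in that case too. *)
Lemma derive_constant_square f I c s d : open I -> I s ->
  (forall t, I t -> f t ^+ 2 = c) -> is_derive s 1 f d -> d = 0.
Proof.
move=> oI Is fc fd.
have := derive_constant_on oI Is fc (is_derive_mul fd fd).
rewrite mulrC -mulr2n => /eqP; rewrite mulrn_eq0/= mulf_eq0.
move=> /orP[/eqP fs0|/eqP//].
apply: (derive_constant_on (c := 0) oI Is _ fd) => t It.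
by apply/eqP; rewrite -sqrf_eq0 fc// -(fc _ Is) fs0 expr0n.
Qed.

Lemma derive_unit_norm I f g h s df dg dh : open I -> I s ->
  (forall t, I t -> f t ^+ 2 + g t ^+ 2 + h t ^+ 2 = 1) ->
  is_derive s 1 f df -> is_derive s 1 g dg -> is_derive s 1 h dh ->
  f s * df + g s * dg + h s * dh = 0.
Proof.
move=> oI Is n1 hf hg hh.
have := derive_constant_on oI Is n1 (is_derive_add (is_derive_add
  (is_derive_mul hf hf) (is_derive_mul hg hg)) (is_derive_mul hh hh)).
lra.
Qed.

Lemma derive0_constant_on I f : is_interval I ->
  (forall s, I s -> is_derive s 1 f 0) ->
  forall s t, I s -> I t -> f s = f t.
Proof.
move=> itI f0.
suff le_eq s t : I s -> I t -> s <= t -> f s = f t.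
  by move=> s t Is It; case: (leP s t) => [|/ltW] st;
    [|apply/esym]; exact: le_eq.
move=> Is It st.
have Iu u : u \in `[s, t] -> I u by rewrite in_itv/=; exact: itI.
have [||u _] := @MVT_segment _ f (cst 0) s t st.
- by move=> u; rewrite in_itv/= => /andP[/ltW su /ltW ut];
    apply: f0; apply: Iu; rewrite in_itv/= su.
- by apply: derivable_within_continuous => u /Iu/f0[].
- by rewrite mul0r => /eqP; rewrite subr_eq0 => /eqP.
Qed.

(** [acos u] has the right cosine and a nonnegative sine, so the sign of [v] decides between it and
    its opposite. *)
Lemma unit_circle_angle (u v : R) : u ^+ 2 + v ^+ 2 = 1 ->
  exists t, u = cos t /\ v = sin t.
Proof.
move=> uv1.
have v2 : v ^+ 2 = 1 - u ^+ 2 by rewrite -uv1; ring.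
have u1 : -1 <= u <= 1.
  by rewrite -ler_norml -(@ler_sqr _ `|u|) ?nnegrE// real_normK ?num_real//; nra.
have [v0|v0] := leP 0 v.
- exists (acos u); rewrite acosK ?in_itv//=; split=> //.
  by rewrite sin_acos// -v2 sqrtr_sqr ger0_norm.
- exists (- acos u); rewrite cosN acosK ?in_itv//=; split=> //.
  by rewrite sinN sin_acos// -v2 sqrtr_sqr ltr0_norm// opprK.
Qed.

(** Supplies the angle of the cone: cosine decreases on [0, pi] and vanishes at pi / 2, so [acos c]
    is acute. *)
Lemma acute_angle (c : R) : 0 < c < 1 ->
  exists2 t, 0 < t < pi / 2 & cos t = c /\ sin t = Num.sqrt (1 - c ^+ 2).
Proof.
move=> /andP[c0 c1].
have c11 : -1 <= c <= 1 by apply/andP; split; lra.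
have acc : cos (acos c) = c by rewrite acosK ?in_itv.
exists (acos c); last by rewrite acc sin_acos.
rewrite acos_gt0/=; last by apply/andP; split; lra.
rewrite ltNge; apply/negP => h.
have : cos (acos c) <= cos (pi / 2) :> R.
  rewrite leNgt; apply/negP.
  rewrite ltr_cos ?in_itv/= ?acos_ge0// ?acos_lepi// ?divr_ge0 ?pi_ge0//.
    by rewrite ltNge h.
  by rewrite ler_pdivrMr// ler_peMr ?pi_ge0// ler1n.
by rewrite acc cos_pihalf leNgt c0.
Qed.

End RealFunctions.

(** * The curve in Cartesian coordinates whose third axis is the slant axis *)

Section Coordinates.
Variables (R : realType) (I : set R) (x y z x1 y1 z1 x2 y2 z2 : R -> R) (k : R).
Hypotheses (openI : open I) (intervalI : is_interval I).
Hypothesis dx : forall s, I s -> is_derive s 1 x (x1 s).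
Hypothesis dy : forall s, I s -> is_derive s 1 y (y1 s).
Hypothesis dz : forall s, I s -> is_derive s 1 z (z1 s).
Hypothesis dx1 : forall s, I s -> is_derive s 1 x1 (x2 s).
Hypothesis dy1 : forall s, I s -> is_derive s 1 y1 (y2 s).
Hypothesis dz1 : forall s, I s -> is_derive s 1 z1 (z2 s).
Hypothesis speed1 : forall s, I s -> x1 s ^+ 2 + y1 s ^+ 2 + z1 s ^+ 2 = 1.
Hypothesis rect :
  forall s, I s -> x s * x2 s + y s * y2 s + z s * z2 s = 0.
Hypothesis accel_gt0 :
  forall s, I s -> 0 < x2 s ^+ 2 + y2 s ^+ 2 + z2 s ^+ 2.
(** This is <n, e_3> = k, multiplied by the curvature and squared. *)
Hypothesis slant : forall s, I s ->
  z2 s ^+ 2 = k ^+ 2 * (x2 s ^+ 2 + y2 s ^+ 2 + z2 s ^+ 2).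

(** [g] is |alpha|^2, [f] is <alpha, t>, and [D] is det(alpha, t, e_3), the angular momentum about
    the third axis. *)
Let g s := x s * x s + y s * y s + z s * z s.
Let f s := x s * x1 s + y s * y1 s + z s * z1 s.
Let D s := x s * y1 s - y s * x1 s.

Let speed_accel s : I s -> x1 s * x2 s + y1 s * y2 s + z1 s * z2 s = 0.
Proof.
by move=> Is; exact: derive_unit_norm openI Is speed1 (dx1 Is) (dy1 Is) (dz1 Is).
Qed.

Let dg s : I s -> is_derive s 1 g (2 * f s).
Proof.
move=> Is; apply: is_derive_eq (is_derive_add (is_derive_add
  (is_derive_mul (dx Is) (dx Is)) (is_derive_mul (dy Is) (dy Is)))
  (is_derive_mul (dz Is) (dz Is))) _.
by rewrite /f; ring.
Qed.

(** f' = |t|^2 + <alpha, t'>, and the second term vanishes by [rect]. *)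
Let df s : I s -> is_derive s 1 f 1.
Proof.
move=> Is; apply: is_derive_eq (is_derive_add (is_derive_add
  (is_derive_mul (dx Is) (dx1 Is)) (is_derive_mul (dy Is) (dy1 Is)))
  (is_derive_mul (dz Is) (dz1 Is))) _.
rewrite -(speed1 Is) -[RHS]addr0 -(rect Is); ring.
Qed.

Let dD s : I s -> is_derive s 1 D (x s * y2 s - y s * x2 s).
Proof.
move=> Is; apply: is_derive_eq (is_derive_sub
  (is_derive_mul (dx Is) (dy1 Is)) (is_derive_mul (dy Is) (dx1 Is))) _.
ring.
Qed.

Variable s0 : R.
Hypothesis I0 : I s0.
Let m := g s0 - f s0 * f s0.

(** (g - f^2)' = 2 f - 2 f f' = 0. Geometrically, all tangent lines are at the same distance from
    the origin, and [m] is its square. *)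
Let gE s : I s -> g s = m + f s * f s.
Proof.
move=> Is; apply/eqP; rewrite -subr_eq; apply/eqP.
apply: (derive0_constant_on (f := fun s => g s - f s * f s) intervalI _ Is I0).
move=> t It; apply: is_derive_eq
  (is_derive_sub (dg It) (is_derive_mul (df It) (df It))) _.
ring.
Qed.

(** Lagrange's identity: |alpha x t|^2 = |alpha|^2 |t|^2 - <alpha, t>^2. *)
Let cross_sqr s : I s ->
  (y s * z1 s - z s * y1 s) ^+ 2 + (z s * x1 s - x s * z1 s) ^+ 2 +
  (x s * y1 s - y s * x1 s) ^+ 2 = m.
Proof.
move=> Is; have := gE Is => /eqP; rewrite -subr_eq => /eqP <-.
rewrite -[g s]mulr1 -(speed1 Is) /g /f; ring.
Qed.

(* If m = 0 then alpha x t = 0 on I, whence alpha x t' = 0; as alpha is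
   orthogonal to t' != 0, alpha would vanish on I, and so would t. *)
Let m_gt0 : 0 < m.
Proof.
have m_ge0 : 0 <= m by rewrite -(cross_sqr I0) !addr_ge0 ?sqr_ge0.
rewrite lt_neqAle m_ge0 andbT eq_sym; apply/eqP => m0.
have cross0 s : I s -> [/\ y s * z1 s - z s * y1 s = 0,
    z s * x1 s - x s * z1 s = 0 & x s * y1 s - y s * x1 s = 0].
  move=> Is; have := cross_sqr Is; rewrite m0 => /eqP.
  rewrite paddr_eq0 ?addr_ge0 ?sqr_ge0// paddr_eq0 ?sqr_ge0// !sqrf_eq0.
  by case/andP => /andP[/eqP-> /eqP->] /eqP->.
have alpha0 s : I s -> x s = 0 /\ y s = 0 /\ z s = 0.
  move=> Is.
  have ha : y s * z2 s - z s * y2 s = 0.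
    have := derive_constant_on openI Is
      (fun t It => let: And3 h _ _ := cross0 t It in h)
      (is_derive_sub (is_derive_mul (dy Is) (dz1 Is)) (is_derive_mul (dz Is) (dy1 Is))).
    by move=> <-; ring.
  have hb : z s * x2 s - x s * z2 s = 0.
    have := derive_constant_on openI Is
      (fun t It => let: And3 _ h _ := cross0 t It in h)
      (is_derive_sub (is_derive_mul (dz Is) (dx1 Is)) (is_derive_mul (dx Is) (dz1 Is))).
    by move=> <-; ring.
  have hc : x s * y2 s - y s * x2 s = 0.
    have := derive_constant_on openI Is
      (fun t It => let: And3 _ _ h := cross0 t It in h)
      (is_derive_sub (is_derive_mul (dx Is) (dy1 Is)) (is_derive_mul (dy Is) (dx1 Is))).
    by move=> <-; ring.
  have : (x2 s ^+ 2 + y2 s ^+ 2 + z2 s ^+ 2) * (x s ^+ 2 + y s ^+ 2 + z s ^+ 2) = 0.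
    transitivity ((y s * z2 s - z s * y2 s) ^+ 2 + (z s * x2 s - x s * z2 s) ^+ 2 +
      (x s * y2 s - y s * x2 s) ^+ 2 + (x s * x2 s + y s * y2 s + z s * z2 s) ^+ 2).
      ring.
    by rewrite ha hb hc (rect Is); ring.
  move=> /eqP; rewrite mulf_eq0 (gt_eqF (accel_gt0 Is))/=.
  rewrite paddr_eq0 ?addr_ge0 ?sqr_ge0// paddr_eq0 ?sqr_ge0// !sqrf_eq0.
  by case/andP => /andP[/eqP-> /eqP->] /eqP->.
have := speed1 I0.
rewrite (derive_constant_on openI I0 (fun t It => proj1 (alpha0 t It)) (dx I0)).
rewrite (derive_constant_on openI I0 (fun t It => proj1 (proj2 (alpha0 t It))) (dy I0)).
rewrite (derive_constant_on openI I0 (fun t It => proj2 (proj2 (alpha0 t It))) (dz I0)).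
by rewrite !expr0n !addr0 => /eqP; rewrite eq_sym oner_eq0.
Qed.

Let g_gt0 s : I s -> 0 < g s.
Proof. by move=> Is; rewrite gE// -expr2 ltr_wpDr ?sqr_ge0. Qed.

(** [E] is det(alpha, t, t') and [K] the squared curvature. *)
Let E s := x s * (y1 s * z2 s - z1 s * y2 s) + y s * (z1 s * x2 s - x1 s * z2 s)
  + z s * (x1 s * y2 s - y1 s * x2 s).
Let K s := x2 s ^+ 2 + y2 s ^+ 2 + z2 s ^+ 2.

Let mE s : I s -> m = g s - f s * f s.
Proof. by move=> Is; rewrite gE// addrK. Qed.

(* These are the products of det(alpha, t, t') with itself, with
   det(alpha, t, e_3) and with det(alpha, t', e_3), as Gram determinants. *)
Let E_sqr s : I s -> E s ^+ 2 = m * K s.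
Proof.
move=> Is.
transitivity ((g s * (x1 s ^+ 2 + y1 s ^+ 2 + z1 s ^+ 2) - f s * f s) * K s
  - g s * (x1 s * x2 s + y1 s * y2 s + z1 s * z2 s) ^+ 2
  - (x s * x2 s + y s * y2 s + z s * z2 s) ^+ 2 * (x1 s ^+ 2 + y1 s ^+ 2 + z1 s ^+ 2)
  + 2 * f s * (x1 s * x2 s + y1 s * y2 s + z1 s * z2 s)
    * (x s * x2 s + y s * y2 s + z s * z2 s)).
  rewrite /E /g /f /K; ring.
rewrite speed1// speed_accel// rect// (mE Is); ring.
Qed.

Let D_E s : I s -> D s * E s = m * z2 s.
Proof.
move=> Is.
transitivity (
   g s * ((x1 s ^+ 2 + y1 s ^+ 2 + z1 s ^+ 2) * z2 s
       - (x1 s * x2 s + y1 s * y2 s + z1 s * z2 s) * z1 s)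
   - f s * (f s * z2 s - (x1 s * x2 s + y1 s * y2 s + z1 s * z2 s) * z s)
   + (x s * x2 s + y s * y2 s + z s * z2 s) *
     (f s * z1 s - (x1 s ^+ 2 + y1 s ^+ 2 + z1 s ^+ 2) * z s)).
  rewrite /E /g /f /D; ring.
rewrite speed1// speed_accel// rect// (mE Is); ring.
Qed.

Let D1_E s : I s ->
  (x s * y2 s - y s * x2 s) * E s = K s * (z s * f s - g s * z1 s).
Proof.
move=> Is.
transitivity (
   g s * ((x1 s * x2 s + y1 s * y2 s + z1 s * z2 s) * z2 s - K s * z1 s)
   - f s * ((x s * x2 s + y s * y2 s + z s * z2 s) * z2 s - K s * z s)
   + (x s * x2 s + y s * y2 s + z s * z2 s) *
     ((x s * x2 s + y s * y2 s + z s * z2 s) * z1 s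
       - (x1 s * x2 s + y1 s * y2 s + z1 s * z2 s) * z s)).
  rewrite /E /g /f /K; ring.
rewrite speed_accel// rect//; ring.
Qed.

(** By [D_E] and [slant], (D E)^2 = m^2 k^2 K; dividing by E^2 = m K, which is positive, leaves m
    k^2. *)
Let D_sqr s : I s -> D s ^+ 2 = m * k ^+ 2.
Proof.
move=> Is.
have Kn0 : K s != 0 by rewrite gt_eqF// accel_gt0.
apply: (mulIf (mulf_neq0 (lt0r_neq0 m_gt0) Kn0)).
rewrite -{1}(E_sqr Is) -exprMn (D_E Is) exprMn slant//.
rewrite /K; ring.
Qed.

Let dD0 s : I s -> x s * y2 s - y s * x2 s = 0.
Proof. by move=> Is; apply: (derive_constant_square openI Is D_sqr); exact: dD. Qed.

(** With D' = 0, [D1_E] reads 0 = K (z f - g z'), and K > 0. *)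
Let z_radial s : I s -> g s * z1 s = z s * f s.
Proof.
move=> Is; have := D1_E Is; rewrite dD0// mul0r => /esym/eqP.
by rewrite mulf_eq0 gt_eqF ?accel_gt0//= subr_eq0 => /eqP.
Qed.

(** * The circular cone containing the curve *)

Let r s := Num.sqrt (g s).
Let r_gt0 s : I s -> 0 < r s. Proof. by move=> /g_gt0; rewrite sqrtr_gt0. Qed.
Let r_sqr s : I s -> r s ^+ 2 = g s.
Proof. by move=> /g_gt0/ltW; exact: sqr_sqrtr. Qed.

Let dr s : I s -> is_derive s 1 r (f s / r s).
Proof.
move=> Is.
apply: is_derive_eq (is_derive_comp (is_derive1_sqrt (g_gt0 Is)) (dg Is)) _.
by rewrite -/(r s); field; rewrite gt_eqF ?r_gt0.
Qed.

(** [C] is the cosine of the angle between alpha(s0) and the third axis; [w] is the common distance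
    of the tangent lines from the origin. *)
Let C := z s0 / r s0.
Let w := Num.sqrt m.
Let w_gt0 : 0 < w. Proof. by rewrite sqrtr_gt0. Qed.
Let w_sqr : w ^+ 2 = m. Proof. exact/sqr_sqrtr/ltW. Qed.

(** The numerator of (z / r)' is g z' - z f, which vanishes by [z_radial]. *)
Let zE s : I s -> z s = C * r s.
Proof.
move=> Is; apply: (canRL (divfK _)); first by rewrite gt_eqF ?r_gt0.
apply: (derive0_constant_on (f := fun s => z s / r s) intervalI _ Is I0).
move=> t It; have rt0 : r t != 0 by rewrite gt_eqF ?r_gt0.
apply: is_derive_eq (is_derive_mul (dz It) (is_derive_inv rt0 (dr It))) _.
transitivity ((g t * z1 t - z t * f t) / r t ^+ 3).
  by rewrite -r_sqr//; field.
by rewrite z_radial// subrr mul0r.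
Qed.

Let z1E s : I s -> z1 s = C * f s / r s.
Proof.
move=> Is; apply: derive_unique (dz Is) _.
apply: (near_eq_is_derive (f := fun s => C * r s)).
  by near=> t; rewrite -zE//; near: t; exact: open_nbhs_nbhs.
apply: is_derive_eq (is_derive_mul (is_derive_cst C s 1) (dr Is)) _.
by rewrite /cst; ring.
Unshelve. all: by end_near. Qed.

Let xyE s : I s -> x s ^+ 2 + y s ^+ 2 = g s * (1 - C ^+ 2).
Proof.
move=> Is; rewrite mulrBr mulr1 -{2}r_sqr// mulrC -exprMn -zE// /g; ring.
Qed.

Let xy1E s : I s -> x s * x1 s + y s * y1 s = f s * (1 - C ^+ 2).
Proof.
move=> Is; transitivity (f s - z s * z1 s); first by rewrite /f; ring.
by rewrite zE// z1E//; field; rewrite gt_eqF ?r_gt0.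
Qed.

(** Two evaluations of D^2 at [s0]: m k^2 on one side, and on the other Lagrange's identity in the
    xy-plane, which the cone equations turn into m (1 - C^2). *)
Let k_sqr : k ^+ 2 = 1 - C ^+ 2.
Proof.
apply: (mulfI (lt0r_neq0 m_gt0)); rewrite -(D_sqr I0).
transitivity ((x s0 ^+ 2 + y s0 ^+ 2) * (1 - z1 s0 ^+ 2)
  - (x s0 * x1 s0 + y s0 * y1 s0) ^+ 2).
  by rewrite -(speed1 I0) /D; ring.
rewrite xyE// xy1E// z1E// [m](mE I0) -(r_sqr I0).
by field; rewrite gt_eqF ?r_gt0.
Qed.

(** If k = 0, the cone degenerates to its axis and the curve is straight, against positive
    curvature. *)
Let k_neq0 : k != 0.
Proof.
apply/eqP => k0.
have C1 : 1 - C ^+ 2 = 0 by rewrite -k_sqr k0 expr0n.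
have xy0 s : I s -> x s = 0 /\ y s = 0.
  move=> Is; have := xyE Is; rewrite C1 mulr0 => /eqP.
  by rewrite paddr_eq0 ?sqr_ge0// !sqrf_eq0 => /andP[/eqP-> /eqP->].
have xy10 s : I s -> x1 s = 0 /\ y1 s = 0.
  move=> Is; split.
    exact: (derive_constant_on openI Is (fun t It => proj1 (xy0 t It)) (dx Is)).
  exact: (derive_constant_on openI Is (fun t It => proj2 (xy0 t It)) (dy Is)).
have := accel_gt0 I0.
rewrite slant// k0 expr0n mul0r.
rewrite (derive_constant_on openI I0 (fun t It => proj1 (xy10 t It)) (dx1 I0)).
rewrite (derive_constant_on openI I0 (fun t It => proj2 (xy10 t It)) (dy1 I0)).
by rewrite !expr0n !addr0 ltxx.
Qed.

(** If C = 0, the curve lies in the plane z = 0, so z'' = 0; but then k^2 = 1 and [slant] makes the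
    whole acceleration vanish. *)
Let C_neq0 : C != 0.
Proof.
apply/eqP => C0.
have z0 s : I s -> z s = 0 by move=> Is; rewrite zE// C0 mul0r.
have z10 s : I s -> z1 s = 0 by move=> Is; exact: derive_constant_on z0 (dz Is).
have z20 := derive_constant_on openI I0 z10 (dz1 I0).
have k1 : k ^+ 2 = 1 by rewrite k_sqr C0; ring.
by have := accel_gt0 I0; rewrite -[ltRHS]mul1r -k1 -slant// z20 expr0n ltxx.
Qed.

(** The signs [e1] and [e2] reflect the curve so that it turns counterclockwise about the third axis
    and stays on the upper half of the cone. Rotating (x, e1 y) back by the expected angle and
    dividing by |alpha| then gives a constant vector. *)
Lemma rectifying_slant_coordinates : exists e1 e2 a b c psi : R,
  [/\ e1 ^+ 2 = 1, e2 ^+ 2 = 1, 0 < a, 0 < psi < pi / 2 &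
    forall s, I s -> let r := a^-1 * Num.sqrt (1 + (a * s + b) ^+ 2) in
      let phi := (c + atan (a * s + b)) / sin psi in
    [/\ x s = r * (sin psi * cos phi), y s * e1 = r * (sin psi * sin phi)
      & z s * e2 = r * cos psi]].
Proof.
have C01 : 0 < `|C| < 1.
  rewrite normr_gt0 C_neq0/= -(@ltr_sqr _ `|C|) ?nnegrE// real_normK ?num_real//.
  by rewrite expr1n -subr_gt0 -k_sqr exprn_even_gt0.
have [psi psi_itv [cpsi spsi]] := acute_angle C01.
rewrite real_normK ?num_real// in spsi.
set S := sin psi in spsi *.
have S_gt0 : 0 < S by rewrite spsi sqrtr_gt0 -k_sqr exprn_even_gt0.
have S_sqr : S ^+ 2 = 1 - C ^+ 2.
  by rewrite spsi sqr_sqrtr// -k_sqr sqr_ge0.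
have D0 : D s0 != 0 by rewrite -sqrf_eq0 D_sqr// mulf_neq0 ?sqrf_eq0// gt_eqF.
pose e1 := Num.sg (D s0); pose e2 := Num.sg C.
have e1_sqr : e1 ^+ 2 = 1 by rewrite sqr_sg D0.
(* D is constant, with D^2 = m k^2 = (S w)^2; the factor [e1] makes it positive. *)
have DE s : I s -> e1 * D s = S * w.
  move=> Is.
  have -> : D s = D s0.
    apply: derive0_constant_on Is I0 => // t It.
    by apply: is_derive_eq (dD It) _; exact: dD0.
  rewrite /e1 -normrEsg; apply/eqP; rewrite -(@eqrXn2 _ 2) ?normr_ge0 ?mulr_ge0
    ?(ltW S_gt0) ?(ltW w_gt0)//.
  by rewrite real_normK ?num_real// D_sqr// exprMn S_sqr w_sqr k_sqr mulrC.
pose b0 := f s0 - s0.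
have fE s : I s -> f s = s + b0.
  move=> Is; apply/eqP; rewrite addrC -subr_eq; apply/eqP.
  apply: (derive0_constant_on (f := fun s => f s - s) intervalI _ Is I0) => t It.
  apply: is_derive_eq (is_derive_sub (df It) (is_derive_id t (1 : R))) _.
  by rewrite subrr.
(* The affine function a s + b of the statement, with a = 1 / w and b = b0 / w; it equals f / w, so
   1 + u^2 = g / m. *)
pose u s := w^-1 * s + b0 / w.
have wn0 : w != 0 by rewrite gt_eqF.
have Sn0 : S != 0 by rewrite gt_eqF.
have uE s : I s -> u s = f s / w by move=> Is; rewrite /u fE//; field.
have u2E s : I s -> 1 + u s ^+ 2 = g s / w ^+ 2.
  by move=> Is; rewrite uE// gE// -w_sqr; field.
have rE s : I s -> w^-1^-1 * Num.sqrt (1 + u s ^+ 2) = r s.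
  move=> Is; rewrite u2E// sqrtrM ?ltW ?g_gt0// sqrtrV ?sqr_ge0//.
  by rewrite sqrtr_sqr gtr0_norm// invrK -/(r s); field.
pose phi s := atan (u s) / S.
have dphi s : I s -> is_derive s 1 phi (w / (S * g s)).
  move=> Is.
  have du : is_derive s 1 u w^-1.
    apply: is_derive_eq (is_derive_add (is_derive_mul (is_derive_cst w^-1 s 1)
      (is_derive_id s (1 : R))) (is_derive_cst (b0 / w) s 1)) _.
    by rewrite /cst; ring.
  apply: is_derive_eq (is_derive_mul (is_derive_comp (is_derive1_atan (u s)) du)
      (is_derive_cst S^-1 s 1)) _.
  rewrite u2E// /cst; field.
  by rewrite wn0 Sn0 gt_eqF ?g_gt0.
(* Solves the linear system given by x x' + y y' = f S^2 and e1 (x y' - y x') = S w, of determinant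
   x^2 + y^2 = g S^2. For zeta = x + i e1 y it says zeta' = zeta (f + i w / S) / g: radial rate r' /
   r, angular velocity phi'. *)
have xy1 s : I s -> x1 s = (x s * f s - e1 * y s * (w / S)) / g s /\
    e1 * y1 s = (e1 * y s * f s + x s * (w / S)) / g s.
  move=> Is; have gn0 : g s != 0 by rewrite gt_eqF ?g_gt0.
  have gSn0 : g s * S ^+ 2 != 0 by rewrite mulf_neq0 ?expf_neq0.
  have h1 := xy1E Is; have h2 := DE _ Is; have h3 := xyE Is.
  rewrite -S_sqr in h1 h3.
  split; apply: (mulIf gSn0).
    rewrite -{1}h3; transitivity (x s * (f s * S ^+ 2) - e1 * y s * (S * w)).
      by rewrite -h1 -h2 /D -[y s ^+ 2]mul1r -e1_sqr; ring: e1_sqr.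
    by field; rewrite gn0.
  rewrite -{1}h3; transitivity (e1 * y s * (f s * S ^+ 2) + x s * (S * w)).
    by rewrite -h1 -h2 /D; ring.
  by field; rewrite gn0 Sn0.
(* X + i Y = zeta exp(-i phi) / r, whose derivative vanishes because both rates cancel. *)
pose X s := (x s * cos (phi s) + e1 * y s * sin (phi s)) / r s.
pose Y s := (e1 * y s * cos (phi s) - x s * sin (phi s)) / r s.
have dcos s : I s -> is_derive s 1 (fun t => cos (phi t))
    (- sin (phi s) * (w / (S * g s))).
  by move=> Is; exact: is_derive_comp (is_derive_cos _) (dphi _ Is).
have dsin s : I s -> is_derive s 1 (fun t => sin (phi t))
    (cos (phi s) * (w / (S * g s))).
  by move=> Is; exact: is_derive_comp (is_derive_sin _) (dphi _ Is).
have dey s : I s -> is_derive s 1 (fun t => e1 * y t) (e1 * y1 s).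
  move=> Is; apply: is_derive_eq (is_derive_mul (is_derive_cst e1 s 1) (dy Is)) _.
  by rewrite /cst; ring.
have XE s : I s -> X s = X s0.
  move=> Is; apply: derive0_constant_on Is I0 => // t It.
  have rn0 : r t != 0 by rewrite gt_eqF ?r_gt0.
  apply: is_derive_eq (is_derive_mul (is_derive_add
    (is_derive_mul (dx It) (dcos _ It)) (is_derive_mul (dey _ It) (dsin _ It)))
    (is_derive_inv rn0 (dr It))) _.
  have [-> ->] := xy1 _ It; rewrite -(r_sqr It).
  by field; rewrite rn0.
have YE s : I s -> Y s = Y s0.
  move=> Is; apply: derive0_constant_on Is I0 => // t It.
  have rn0 : r t != 0 by rewrite gt_eqF ?r_gt0.
  apply: is_derive_eq (is_derive_mul (is_derive_sub
    (is_derive_mul (dey _ It) (dcos _ It)) (is_derive_mul (dx It) (dsin _ It)))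
    (is_derive_inv rn0 (dr It))) _.
  have [-> ->] := xy1 _ It; rewrite -(r_sqr It).
  by field; rewrite rn0.
(* The vector (X, Y) has length S, as x^2 + y^2 = r^2 S^2; [th] is its polar angle. *)
have [th [cth sth]] : exists th, X s0 / S = cos th /\ Y s0 / S = sin th.
  apply: unit_circle_angle.
  have rn0 : r s0 != 0 by rewrite gt_eqF ?r_gt0.
  transitivity ((x s0 ^+ 2 + e1 ^+ 2 * y s0 ^+ 2) *
      (cos (phi s0) ^+ 2 + sin (phi s0) ^+ 2) / (r s0 ^+ 2 * S ^+ 2)).
    by rewrite /X /Y; field; rewrite rn0 Sn0.
  rewrite e1_sqr mul1r cos2Dsin2 xyE// S_sqr mulr1 r_sqr// divff//.
  by rewrite -S_sqr mulf_neq0 ?expf_neq0// gt_eqF ?g_gt0.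
(* The constant c is [th * S] because the formula divides it by sin psi. *)
exists e1, e2, w^-1, (b0 / w), (th * S), psi; split=> //.
- by rewrite /e2 sqr_sg C_neq0.
- by rewrite invr_gt0.
move=> s Is /=; rewrite -/S -/(u s) rE//.
have -> : (th * S + atan (u s)) / S = th + phi s by rewrite /phi; field.
have rn0 : r s != 0 by rewrite gt_eqF ?r_gt0.
rewrite cosD sinD -cth -sth -(XE s Is) -(YE s Is); split.
- transitivity (x s * (cos (phi s) ^+ 2 + sin (phi s) ^+ 2)).
    by rewrite cos2Dsin2 mulr1.
  by rewrite /X /Y; field; rewrite rn0 Sn0.
- transitivity (e1 * y s * (cos (phi s) ^+ 2 + sin (phi s) ^+ 2)).
    by rewrite cos2Dsin2 mulr1 mulrC.
  by rewrite /X /Y; field; rewrite rn0 Sn0.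
- by rewrite zE// cpsi normrEsg /e2; ring.
Qed.

End Coordinates.

(** * Euclidean geometry of row vectors and orthogonal changes of coordinates *)

Section EuclideanSpace.
Variable R : realType.
Implicit Types (u v : 'rV[R]_3) (Q : 'M[R]_3) (I : set R) (alpha : R -> 'rV[R]_3).

Lemma row3P u v :
  u 0 (inord 0) = v 0 (inord 0) -> u 0 (inord 1) = v 0 (inord 1) ->
  u 0 (inord 2) = v 0 (inord 2) -> u = v.
Proof.
move=> h0 h1 h2; apply/rowP => -[[|[|[|//]]] lti3].
- by rewrite (_ : Ordinal _ = inord 0)//; apply/val_inj; rewrite /= inordK.
- by rewrite (_ : Ordinal _ = inord 1)//; apply/val_inj; rewrite /= inordK.
- by rewrite (_ : Ordinal _ = inord 2)//; apply/val_inj; rewrite /= inordK.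
Qed.

Lemma vec3E (a b c : R) :
  (vec3 a b c 0 (inord 0) = a) * (vec3 a b c 0 (inord 1) = b) *
  (vec3 a b c 0 (inord 2) = c).
Proof. by rewrite !mxE !inordK. Qed.

Lemma dotE u v : dot u v = u 0 (inord 0) * v 0 (inord 0) +
  u 0 (inord 1) * v 0 (inord 1) + u 0 (inord 2) * v 0 (inord 2).
Proof.
rewrite /dot !big_ord_recl big_ord0 addr0 addrA.
by congr (_ * _ + _ * _ + _ * _); congr (_ 0 _); apply/val_inj; rewrite /= inordK.
Qed.

Lemma dot_mulmx u v : dot u v = (u *m v^T) 0 0.
Proof. by rewrite mxE; apply: eq_bigr => i _; rewrite mxE. Qed.

Lemma dotDl u u' v : dot (u + u') v = dot u v + dot u' v.
Proof. by rewrite !dot_mulmx mulmxDl mxE. Qed.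

Lemma dotZl (a : R) u v : dot (a *: u) v = a * dot u v.
Proof. by rewrite !dot_mulmx -scalemxAl mxE. Qed.

Lemma dotC u v : dot u v = dot v u.
Proof. by apply: eq_bigr => i _; rewrite mulrC. Qed.

Lemma dot_ge0 u : 0 <= dot u u.
Proof. by apply: sumr_ge0 => i _; rewrite -expr2 sqr_ge0. Qed.

Lemma dot_eq0 u : dot u u = 0 -> u = 0.
Proof.
move=> /eqP; rewrite psumr_eq0; last by move=> i _; rewrite -expr2 sqr_ge0.
move=> /allP u0; apply/rowP => i; rewrite mxE; apply/eqP.
by have := u0 i (mem_index_enum _); rewrite mulf_eq0 orbb.
Qed.

Lemma enorm_sqr u : enorm u ^+ 2 = dot u u.
Proof. exact/sqr_sqrtr/dot_ge0. Qed.

Lemma dot_cross u v : dot (cross u v) v = 0.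
Proof. by rewrite dotE /cross !vec3E; ring. Qed.

Lemma dot_orthogonal Q u v : Q *m Q^T = 1%:M -> dot (u *m Q) (v *m Q) = dot u v.
Proof.
by move=> QQ; rewrite !dot_mulmx trmx_mul mulmxA -(mulmxA u) QQ mulmx1.
Qed.

(* Q is the reflection exchanging U and e_3 (the identity when U = e_3, since
   then w = 0 and 2 / 0 = 0). *)
Lemma orthogonal_completion U : enorm U = 1 ->
  exists Q, Q *m Q^T = 1%:M /\ forall v, (v *m Q) 0 (inord 2) = dot v U.
Proof.
move=> U1.
pose e : 'rV[R]_3 := delta_mx 0 (inord 2).
pose w := U - e; pose n := dot w w; pose c := 2 / n.
(* This makes the reflection 1 - c P an involution: its square is 1 - 2 c P + c^2 n P. *)
have ccn : c * c * n = 2 * c.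
  rewrite /c; have [->|n0] := eqVneq n 0; first by rewrite invr0; ring.
  by field.
pose P := w^T *m w.
have PP : P *m P = n *: P.
  rewrite /P mulmxA -(mulmxA w^T) (mx11_scalar (w *m w^T)) -dot_mulmx.
  by rewrite mul_mx_scalar -scalemxAl.
have PT : P^T = P by rewrite /P trmx_mul trmxK.
exists (1%:M - c *: P); split.
  have -> : (1%:M - c *: P)^T = 1%:M - c *: P.
    by rewrite linearB/= linearZ/= trmx1 PT.
  rewrite mulmxBl mul1mx mulmxBr mulmx1.
  rewrite -scalemxAl -scalemxAr PP !scalerA ccn -[RHS]subr0 -addrA -opprD.
  congr (_ - _).
  by rewrite addrA -scalerDl -scalerBl (_ : c + c - _ = 0) ?scale0r//; ring.
move=> v.
have vw : dot v U = dot v w + v 0 (inord 2).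
  rewrite -[U](subrK e) dotC dotDl dotC; congr (_ + _).
  by rewrite dotE /e !mxE !eqxx/= -!val_eqE/= !inordK//=; ring.
have -> : (v *m (1%:M - c *: P)) 0 (inord 2) =
    v 0 (inord 2) - c * (dot v w * w 0 (inord 2)).
  rewrite mulmxBr mulmx1 mxE; congr (_ + _).
  rewrite mxE -scalemxAr mxE /P mulmxA (mx11_scalar (v *m w^T)) -dot_mulmx.
  by rewrite mul_scalar_mx mxE.
(* For unit U, |U - e_3|^2 = 2 - 2 U_3, while the third coordinate of [w] is U_3 - 1. *)
have n2 : n = - 2 * w 0 (inord 2).
  have : dot U U = 1 by rewrite -enorm_sqr U1 expr1n.
  rewrite /n !dotE /w /e !mxE !eqxx/= -!val_eqE/= !inordK//= => UU; lra.
rewrite vw; have [n0|n0] := eqVneq n 0.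
  by rewrite /c n0 invr0 (dot_eq0 n0) !dotE !mxE; ring.
rewrite /c n2; field.
by move: n0; rewrite n2 mulf_eq0 negb_or => /andP[].
Qed.

Lemma is_derive_mulmx_coord alpha s Q j : derivable alpha s 1 ->
  is_derive s 1 (fun t => (alpha t *m Q) 0 j) ((derive1 alpha s *m Q) 0 j).
Proof.
move=> da.
have dc i : is_derive s 1 (fun t => alpha t 0 i * Q i j) (derive1 alpha s 0 i * Q i j).
  have dai : is_derive s 1 (fun t => alpha t 0 i) (derive1 alpha s 0 i).
    rewrite derive1E derive_mx// mxE; apply: derivableP.
    by move/derivable_mxP : da; exact.
  apply: is_derive_eq (is_derive_mul dai (is_derive_cst (Q i j) s 1)) _.
  by rewrite mulr0 addr0.
rewrite mxE (_ : (fun _ => _) = \sum_i (fun t => alpha t 0 i * Q i j)).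
  exact: is_derive_sum.
by apply/funext => t; rewrite mxE fct_sumE.
Qed.

Lemma unit_speed_acceleration I alpha s : open I -> unit_speed I alpha -> I s ->
  dot (derive1 alpha s) (derive1 (derive1 alpha) s) = 0.
Proof.
move=> oI us Is; have [_ dda _] := us s Is.
(* The identity matrix yields the plain coordinates. *)
have dc j := is_derive_mulmx_coord 1%:M j dda.
rewrite -[X in dot X _]mulmx1 -[X in dot _ X]mulmx1 dotE.
apply: (derive_unit_norm oI Is _ (dc _) (dc _) (dc _)) => t It.
have [_ _ n1] := us t It.
by rewrite !mulmx1 !expr2 -dotE -enorm_sqr n1 expr1n.
Qed.

(** alpha is a combination of t and b. The first is orthogonal to alpha'' by unit speed, the second
    because b is a multiple of t x alpha''. *)
Lemma rectifying_acceleration I alpha s : open I -> rectifying I alpha -> I s ->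
  dot (alpha s) (derive1 (derive1 alpha) s) = 0.
Proof.
move=> oI [us rect] Is; have := rect s Is.
rewrite span_cons span_seq1 => /memv_addP[_ /vlineP[p ->]] [_ /vlineP[q ->]] ->.
rewrite dotDl !dotZl (unit_speed_acceleration oI us Is) mulr0 add0r.
set a := derive1 (derive1 alpha) s.
have -> : dot (binormal alpha s) a =
    (curvature alpha s)^-1 * dot (cross (tangent alpha s) a) a.
  by rewrite /binormal /normal -/a !dotE /cross !vec3E !mxE; ring.
by rewrite dot_cross !mulr0.
Qed.

End EuclideanSpace.

(* The formula holds in suitable Cartesian coordinates with the same origin
   (rectifying curves are defined through the position vector), that is after
   applying an orthogonal matrix Q. *)
Theorem theorem3p6 (R : realType) (I : set R) (alpha : R -> 'rV[R]_3)
    (openI : open I) (intervalI : is_interval I)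
    (alpha_unit : unit_speed I alpha)
    (kappa_gt0 : forall s, I s -> 0 < curvature alpha s)
    (alpha_rect : rectifying I alpha)
    (alpha_slant : slant_helix I alpha) :
  exists (Q : 'M[R]_3) (a b c psi0 : R),
    [/\ Q *m Q^T = 1%:M, 0 < a, 0 < psi0 < pi / 2 &
      forall s, I s ->
        alpha s *m Q =
        (a^-1 * Num.sqrt (1 + (a * s + b) ^+ 2)) *:
          vec3 (sin psi0 * cos ((c + atan (a * s + b)) / sin psi0))
               (sin psi0 * sin ((c + atan (a * s + b)) / sin psi0))
               (cos psi0)].
Proof.
(* On an empty interval any admissible constants do; otherwise a base point is available. *)
have [->|/set0P[s0 I0]] := eqVneq I set0.
  exists 1%:M, 1, 0, 0, (pi / 4).
  by have := pi_gt0 R; split => //; [rewrite trmx1 mulmx1|apply/andP; split; lra].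
have [_ _ [U [U1 [k nUk]]]] := alpha_slant.
have [Q [QQ QU]] := orthogonal_completion U1.
(* Coordinates after applying [Q]; by [QU] the third one is the component along the axis U. *)
pose coord (v : R -> 'rV[R]_3) (j : nat) s := (v s *m Q) 0 (inord j).
pose v := derive1 alpha; pose a := derive1 v.
have dotQ u u' : dot u u' = (u *m Q) 0 (inord 0) * (u' *m Q) 0 (inord 0) +
    (u *m Q) 0 (inord 1) * (u' *m Q) 0 (inord 1) +
    (u *m Q) 0 (inord 2) * (u' *m Q) 0 (inord 2).
  by rewrite -(dot_orthogonal u u' QQ) dotE.
have dv j s : I s -> is_derive s 1 (coord alpha j) (coord v j s).
  by move=> /alpha_unit[da _ _]; exact: is_derive_mulmx_coord.
have da j s : I s -> is_derive s 1 (coord v j) (coord a j s).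
  by move=> /alpha_unit[_ dda _]; exact: is_derive_mulmx_coord.
have accel s : coord a 0 s ^+ 2 + coord a 1 s ^+ 2 + coord a 2 s ^+ 2 =
    curvature alpha s ^+ 2.
  by rewrite /curvature enorm_sqr dotQ.
have [||||e1 [e2 [ra [b [c [psi [e1_1 e2_1 ra_gt0 psi_itv H]]]]]]] :=
  rectifying_slant_coordinates openI intervalI (dv 0%N) (dv 1%N) (dv 2%N)
    (da 0%N) (da 1%N) (da 2%N) (k := k) _ _ _ _ I0.
- move=> s Is; have [_ _ n1] := alpha_unit s Is.
  by rewrite !expr2 -dotQ -enorm_sqr n1 expr1n.
- by move=> s Is; rewrite -dotQ (rectifying_acceleration openI alpha_rect).
- by move=> s Is; rewrite accel exprn_gt0 ?kappa_gt0.
- move=> s Is; rewrite accel -exprMn; congr (_ ^+ 2).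
  rewrite /coord QU -(nUk s Is) /normal dotZl mulrC mulrA mulfV ?mul1r//.
  by rewrite gt_eqF ?kappa_gt0.
(* The reflections diag(1, e1, e2) absorb the two signs; the product stays orthogonal because e1^2 =
   e2^2 = 1. *)
exists (Q *m diag_mx (vec3 1 e1 e2)), ra, b, c, psi; split=> //.
  rewrite trmx_mul tr_diag_mx mulmxA -(mulmxA Q) mulmx_diag.
  rewrite (_ : \row_j _ = const_mx 1) ?diag_const_mx ?mulmx1//.
  by apply: row3P; rewrite !mxE !inordK//= ?mulr1 -?expr2.
move=> s Is; have [hx hy hz] := H s Is.
rewrite mulmxA mul_mx_diag.
by apply: row3P; rewrite [LHS]mxE [RHS]mxE !vec3E ?mulr1.
Qed.
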